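(* In the framework described in the context, assume that $\mathcal{X}$, $\mathcal{Q}$ and $\mathcal{Z}$ are Hilbert spaces. Let $\{\mathcal{X}_h;\,h>0\}$ be a family of finite dimensional subspaces of $\mathcal{X}$. Let $\mathcal{S}$ be a set dense in $\mathcal{X}$ and assume that $$\lim_{h\to0}\ \inf_{V_h\in\mathcal{X}_h}\|V-V_h\|_{\mathcal{X}}=0\qquad\forall\,V\in\mathcal{S}.$$ Assume that there exists $\gamma_0>0$ (independent of $h$) such that for all $\Psi\in\mathcal{Y}$, with $W=\mathcal{T}\Psi$ and $W_h=\mathcal{T}_h\Psi$, $$\|W-W_h\|_{\mathcal{X}}\le\gamma_0\inf_{V_h\in\mathcal{X}_h}\|W-V_h\|_{\mathcal{X}} .$$ Then $$\lim_{h\to0}\|(\mathcal{T}-\mathcal{T}_h)\Psi\|_{\mathcal{X}}=0\qquad\forall\,\Psi\in\mathcal{Y}.$$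
   Context: An isomorphism between normed spaces is a linear continuous bijection with continuous inverse. $L(E,F)$ is the space of continuous linear operators from $E$ to $F$. Framework. $\mathcal{Q},\mathcal{X},\mathcal{Y},\mathcal{Z}$ are Banach spaces, $\widehat{\Gamma}=\mathcal{Q}\times\mathcal{X}$, $\widehat{\Sigma}=\mathcal{Z}\times\mathcal{Y}$, $\widehat{\Delta}=\mathcal{Z}\times\mathcal{X}$ (products with the sum of norms). $\mathcal{T}$ is an isomorphism of $\mathcal{Y}$ onto $\mathcal{X}$. $\mathcal{G}\in L(\mathcal{Q}\times\mathcal{X},\mathcal{Y})$, $\mathcal{B}\in L(\mathcal{Q}\times\mathcal{X},\mathcal{Z})$, and the operator $\widehat{\mathcal{A}}(x,U)=[\mathcal{B}(x,U),\,U-\mathcal{T}\mathcal{G}(x,U)]^T$ is an isomorphism of $\widehat{\Gamma}$ onto $\widehat{\Delta}$. For each $h>0$, $\mathcal{X}_h$ is a closed subspace of $\mathcal{X}$ and $\mathcal{T}_h\in L(\mathcal{Y},\mathcal{X}_h)$ with $\mathcal{X}_h=\mathcal{T}_h(\mathcal{Y})$. *)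

(* Defs.v *)
From HB Require Import structures.
From mathcomp Require Import all_boot all_order all_algebra.
From mathcomp Require Import all_classical all_reals all_analysis.

Set Implicit Arguments.
Unset Strict Implicit.
Unset Printing Implicit Defensive.

Import Order.TTheory GRing.Theory Num.Theory.
Import numFieldNormedType.Exports.

Local Open Scope classical_set_scope.
Local Open Scope ring_scope.

Definition isomorphism (R : realType) (E F : normedModType R) (f : E -> F) :
    Prop :=
  [/\ linear f, continuous f &
      exists g : F -> E, [/\ cancel f g, cancel g f & continuous g]].

(* The norm of a completeNormedModType is required to be the one induced by an
   inner product; completeness is already part of the type. *)
Definition hilbert (R : realType) (V : completeNormedModType R) : Prop :=
  exists dot : {dot V for idfun}, forall v : V, dot v v = `|v| ^+ 2.

Definition vector_subspace (R : realType) (V : normedModType R) (A : set V) :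
    Prop :=
  submod_closed (mem A).

Definition finite_dimensional (R : realType) (V : normedModType R)
    (A : set V) : Prop :=
  exists (n : nat) (e : 'I_n -> V),
    A = [set \sum_(i < n) c i *: e i | c in [set: 'I_n -> R]].

(* The infimum is a genuine one as soon as A is nonempty, e.g. a subspace. *)
Definition best_error (R : realType) (V : normedModType R) (A : set V)
    (v : V) : R :=
  inf [set `|v - w| | w in A].

(* The library norm on a product is the maximum of the norms. It is equivalent
   to their sum, so that products carry the same topology, hence the same
   continuous maps and the same isomorphisms, for either norm. *)
Lemma prod_norm_sum (R : realType) (E F : normedModType R) (p : E * F) :
  `|p| <= `|p.1| + `|p.2| <= 2 * `|p|.
Proof.
rewrite prod_normE mulr2n mulrDl mul1r ge_max lerDl lerDr !normr_ge0 /=.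
by apply: lerD; rewrite le_max lexx ?orbT.
Qed.

Definition Ahat (R : realType) (Q X Y Z : normedModType R) (T : Y -> X)
    (G : Q * X -> Y) (B : Q * X -> Z) : Q * X -> Z * X :=
  fun p => (B p, p.2 - T (G p)).

(* Main.v *)
(* The best approximation error is 1-Lipschitz in the approximated vector,
   uniformly in the approximating set; so its pointwise convergence to 0
   extends from a dense set to the whole space, and quasi-optimality
   concludes. *)

Require Import Defs.
From HB Require Import structures.
From mathcomp Require Import all_boot all_order all_algebra.
From mathcomp Require Import all_classical all_reals all_analysis.

Set Implicit Arguments.
Unset Strict Implicit.
Unset Printing Implicit Defensive.

Import Order.TTheory GRing.Theory Num.Theory.
Import numFieldNormedType.Exports.

Local Open Scope classical_set_scope.
Local Open Scope ring_scope.

Lemma best_error_le_norm (R : realType) (V : normedModType R) (A : set V)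
  (v w : V) : A w -> best_error A v <= `|v - w|.
Proof.
move=> Aw; apply: ge_inf; last by exists w.
by exists 0 => _ [u _ <-]; exact: normr_ge0.
Qed.

Lemma best_error_ge0 (R : realType) (V : normedModType R) (A : set V)
  (v : V) : A !=set0 -> 0 <= best_error A v.
Proof.
move=> [a Aa]; apply: lb_le_inf; first by exists `|v - a|, a.
by move=> _ [u _ <-]; exact: normr_ge0.
Qed.

(** For each [u] in [A] the triangle inequality through [w] bounds [|v - u|]; taking the infimum
    over [u] gives a constant 1 that does not depend on [A]. *)
Lemma best_error_lipschitz (R : realType) (V : normedModType R) (A : set V)
  (v w : V) : A !=set0 -> best_error A v <= `|v - w| + best_error A w.
Proof.
(* With [|v - w|] moved to the left, the goal says that a fixed number is a lower bound of the
   distances from [w] to [A]. *)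
move=> [a Aa]; rewrite -lerBlDl; apply: lb_le_inf; first by exists `|w - a|, a.
move=> _ [u Au <-]; rewrite lerBlDl.
exact: le_trans (best_error_le_norm v Au) (ler_distD w v u).
Qed.

Lemma best_error_cvg_dense (R : realType) (V : normedModType R) (I : Type)
    (F : set_system I) {FF : Filter F} (A : I -> set V) (S : set V) :
  dense S -> (\forall i \near F, A i !=set0) ->
  (forall v, S v -> best_error (A i) v @[i --> F] --> 0) ->
  forall v, best_error (A i) v @[i --> F] --> 0.
Proof.
move=> Sd A0 Scvg v; apply/cvgr0Pnorm_lt => e e0.
have e2 : 0 < e / 2 by rewrite divr_gt0.
(* Half of [e] pays for replacing [v] by a nearby [w] in [S], the other half for the error at [w];
   [w] is chosen before the index [i]. *)
have [w [vw Sw]] : ball v (e / 2) `&` S !=set0.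
  by apply: Sd; [exists v; exact: ballxx | exact: ball_open].
have /cvgr0Pnorm_lt/(_ _ e2) := Scvg w Sw.
apply: filterS2 A0 => i Ai; rewrite !ger0_norm ?best_error_ge0// => we.
apply: le_lt_trans (best_error_lipschitz v w Ai) _.
by rewrite (splitr e) ltrD//; move: vw; rewrite -ball_normE.
Qed.

Theorem corollary4p5 (R : realType) (Q X Y Z : completeNormedModType R)
  (T : {linear Y -> X}) (G : {linear (Q * X)%type -> Y})
  (B : {linear (Q * X)%type -> Z})
  (Xh : R -> set X) (Th : R -> {linear Y -> X}) (S : set X)
  (T_iso : isomorphism T)
  (G_cont : continuous G) (B_cont : continuous B)
  (Ahat_iso : isomorphism (Ahat T G B))
  (Xh_subspace : forall h : R, 0 < h -> vector_subspace (Xh h))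
  (Xh_closed : forall h : R, 0 < h -> closed (Xh h))
  (Th_cont : forall h : R, 0 < h -> continuous (Th h))
  (Th_onto : forall h : R, 0 < h -> Xh h = Th h @` [set: Y])
  (X_hilbert : hilbert X) (Q_hilbert : hilbert Q) (Z_hilbert : hilbert Z)
  (Xh_findim : forall h : R, 0 < h -> finite_dimensional (Xh h))
  (S_dense : dense S)
  (S_approx : forall V : X, S V -> best_error (Xh h) V @[h --> 0^'+] --> 0)
  (quasi_opt : exists2 gamma0 : R, 0 < gamma0 &
     forall h : R, 0 < h -> forall Psi : Y,
       `|T Psi - Th h Psi| <= gamma0 * best_error (Xh h) (T Psi)) :
  forall Psi : Y, `|T Psi - Th h Psi| @[h --> 0^'+] --> 0.
Proof.
move=> Psi; have [g _ Tg] := quasi_opt.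
have h0 : \forall h \near (0 : R)^'+, 0 < h by exact: nbhs_right_gt.
have Xh0 : \forall h \near (0 : R)^'+, Xh h !=set0.
  (* For [h > 0] the subspace [Xh h] contains 0. *)
  by apply: filterS h0 => h /Xh_subspace[] /set_mem; exists 0.
have gcvg : g * best_error (Xh h) (T Psi) @[h --> 0^'+] --> 0.
  rewrite -[X in _ --> X](mulr0 g); apply: cvgM; first exact: cvg_cst.
  exact: (best_error_cvg_dense S_dense Xh0 S_approx).
(* Quasi-optimality squeezes the error between 0 and [g] times the best error at [T Psi]; [g] is
   independent of [h]. *)
apply: squeeze_cvgr (cvg_cst 0) gcvg.
by apply: filterS h0 => h h0; rewrite normr_ge0 Tg.
Qed.
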